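(* The logic $\mathsf{IP}$ is sound and complete with respect to the class of finite preferential models with the inflationary injection semantics; that is, for every formula $\varphi\in\mathcal{L}$, $\varphi$ is a theorem of $\mathsf{IP}$ if and only if $\mathcal{M},w\vDash\varphi$ for every finite preferential model $\mathcal{M}=\langle W,\succeq,V\rangle$ and every $w\in W$. Moreover, $\mathsf{IP}$ is complete with respect to the class of finite preferential models in which $\succeq$ is a total preorder on $W_\succeq$ (i.e., for all $w,v\in W_\succeq$, $w\succeq v$ or $v\succeq w$); that is, if $\mathcal{M},w\vDash\varphi$ for every such model $\mathcal{M}$ and every state $w$ of $\mathcal{M}$, then $\varphi$ is a theorem of $\mathsf{IP}$.
   Context: **Language.** Fix a set $\mathsf{Prop}$ of propositional variables. The language $\mathcal{L}$ is given by the grammar $\varphi::= p\mid \neg\varphi\mid (\varphi\wedge\varphi)\mid (\varphi\succsim\varphi)$ with $p\in\mathsf{Prop}$; $\vee,\to,\leftrightarrow,\bot,\top$ are defined as usual. Inequalities $\succsim$ may be nested. **Preferential models.** A preferential model is a tuple $\mathcal{M}=\langle W,\succeq,V\rangle$ where $W$ is a nonempty set, $V\colon\mathsf{Prop}\to\wp(W)$, and $\succeq$ is a preorder (reflexive and transitive relation) on a nonempty subset $W_\succeq$ of $W$. It is finite if $W$ is finite. **Inflationary injection semantics.** For $A,B\subseteq W_\succeq$, write $A\succeq^i B$ iff there is an injection $f\colon B\to A$ that is inflationary, i.e., $f(x)\succeq x$ for all $x\in B$. For $w\in W$ define: $\mathcal{M},w\vDash p$ iff $w\in V(p)$; $\mathcal{M},w\vDash\neg\varphi$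 iff $\mathcal{M},w\nvDash\varphi$; $\mathcal{M},w\vDash\varphi\wedge\psi$ iff $\mathcal{M},w\vDash\varphi$ and $\mathcal{M},w\vDash\psi$; $\mathcal{M},w\vDash\varphi\succsim\psi$ iff $\llbracket\varphi\rrbracket^{\mathcal{M}}\succeq^i\llbracket\psi\rrbracket^{\mathcal{M}}$, where $\llbracket\alpha\rrbracket^{\mathcal{M}}=\{w\in W_\succeq\mid \mathcal{M},w\vDash\alpha\}$ (note the restriction to $W_\succeq$). **Balancedness formula.** Given formulas $\varphi_1,\dots,\varphi_m,\psi_1,\dots,\psi_m$ and $0\le j\le m$, let $C_j$ be the disjunction of all conjunctions $f_1\varphi_1\wedge\dots\wedge f_m\varphi_m\wedge g_1\psi_1\wedge\dots\wedge g_m\psi_m$ where exactly $j$ of the $f$'s and exactly $j$ of the $g$'s are the empty string and the rest are $\neg$. Let $(\varphi_1,\dots,\varphi_m)\equiv(\psi_1,\dots,\psi_m)$ abbreviate $C_0\vee\dots\vee C_m$ (true at a state iff the number of true $\varphi_i$'s equals the number of true $\psi_i$'s). **The logic $\mathsf{IP}$.** The set of theorems of $\mathsf{IP}$ is the smallest set of formulas of $\mathcal{L}$ that contains all (substitution instances in $\mathcal{L}$ of) tautologies of propositional logic, is closed under modus ponens (if $\varphi$ and $\varphi\to\psi$ are in $\mathsf{IP}$, so is $\psi$) and necessitation (if $\varphi\in\mathsf{IP}$ then $(\varphi\succsim\top)\in\mathsf{IP}$), and contains all instances of the following schemas, for all natural numbers $n$ and all $k\ge 1$: - (A1) $\varphi\succsim\bot$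 - (A2) $\varphi\succsim\varphi$ - (A3) $\neg(\bot\succsim\top)$ - (A4') $\big[(\varphi_1\succsim\psi_1)\wedge\dots\wedge(\varphi_n\succsim\psi_n)\wedge\big(\big((\varphi_1,\dots,\varphi_n,\underbrace{\varphi',\dots,\varphi'}_{k\text{ times}})\equiv(\psi_1,\dots,\psi_n,\underbrace{\psi',\dots,\psi'}_{k\text{ times}})\big)\succsim\top\big)\big]\to(\psi'\succsim\varphi')$ - (I1) $(\varphi\succsim\psi)\to((\varphi\succsim\psi)\succsim\top)$ - (I2) $\neg(\varphi\succsim\psi)\to(\neg(\varphi\succsim\psi)\succsim\top)$. *)

(* Defs.v *)
From mathcomp Require Import all_boot all_classical.

Set Implicit Arguments.
Unset Strict Implicit.
Unset Printing Implicit Defensive.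

Local Open Scope classical_set_scope.

Inductive form (P : Type) : Type :=
| Var of P
| Neg of form P
| And of form P & form P
| Geq of form P & form P.

Definition Or P (a b : form P) : form P := Neg (And (Neg a) (Neg b)).
Definition Imp P (a b : form P) : form P := Neg (And a (Neg b)).

(* The grammar has no primitive constant, so falsum is built from a fixed
   variable p0; this is the only use of p0, here and in everything below. *)
Definition Bot P (p0 : P) : form P := And (Var p0) (Neg (Var p0)).
Definition Top P (p0 : P) : form P := Neg (Bot p0).

(* No constant is appended to a nonempty list; the value on [::] is a dummy as
   far as [IP] is concerned, where these are only applied to nonempty lists. *)
Fixpoint bigAnd P (p0 : P) (s : seq (form P)) : form P :=
  match s with
  | [::] => Top p0
  | [:: a] => a
  | a :: s' => And a (bigAnd p0 s')
  end.

Fixpoint bigOr P (p0 : P) (s : seq (form P)) : form P :=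
  match s with
  | [::] => Bot p0
  | [:: a] => a
  | a :: s' => Or a (bigOr p0 s')
  end.

Record model (P : Type) := Model {
  world :> Type;
  dom : set world;
  pref : world -> world -> Prop;
  val : P -> set world;
  world_nonempty : [set: world] !=set0;
  dom_nonempty : dom !=set0;
  pref_dom : forall x y, pref x y -> dom x /\ dom y;
  pref_refl : forall x, dom x -> pref x x;
  pref_trans : forall x y z, pref x y -> pref y z -> pref x z }.

Definition finite_model P (M : model P) : Prop := finite_set [set: M].

Definition total_model P (M : model P) : Prop :=
  forall w v : M, dom w -> dom v -> pref w v \/ pref v w.

(* An injection from B to A is given by a map on all worlds, of which only the
   restriction to B matters. *)
Definition infl_ge P (M : model P) (A B : set M) : Prop :=
  exists f : M -> M,
    [/\ set_fun B A f, set_inj B f & forall x, B x -> pref (f x) x].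

Fixpoint sat P (M : model P) (w : M) (phi : form P) : Prop :=
  match phi with
  | Var p => val p w
  | Neg a => ~ sat w a
  | And a b => sat w a /\ sat w b
  | Geq a b => infl_ge [set v : M | dom v /\ sat v a]
                       [set v : M | dom v /\ sat v b]
  end.

(* [true] stands for the empty string, [false] for negation. *)
Definition lit P (b : bool) (a : form P) : form P := if b then a else Neg a.

Definition signed P m (f : m.-tuple bool) (phi : m.-tuple (form P)) :
    seq (form P) :=
  [seq lit x.1 x.2 | x <- zip f phi].

Definition signs (m j : nat) : seq (m.-tuple bool) :=
  [seq f : m.-tuple bool <- enum {: m.-tuple bool} | count id f == j].

Definition balC P (p0 : P) m (phi psi : m.-tuple (form P)) (j : nat) : form P :=
  bigOr p0 [seq bigAnd p0 (signed f phi ++ signed g psi)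
           | f <- signs m j, g <- signs m j].

Definition balanced P (p0 : P) m (phi psi : m.-tuple (form P)) : form P :=
  bigOr p0 [seq balC p0 phi psi j | j <- iota 0 m.+1].

(* Formulas of propositional logic, over their own countable supply of
   variables: P may be finite, so tautologies in the variables of P alone would
   have too few substitution instances. *)
Inductive pform : Type :=
| PVar of nat
| PNeg of pform
| PAnd of pform & pform.

Fixpoint peval (v : nat -> bool) (t : pform) : bool :=
  match t with
  | PVar i => v i
  | PNeg a => ~~ peval v a
  | PAnd a b => peval v a && peval v b
  end.

Definition tautology (t : pform) : Prop := forall v, peval v t.

Fixpoint psubst P (s : nat -> form P) (t : pform) : form P :=
  match t with
  | PVar i => s i
  | PNeg a => Neg (psubst s a)
  | PAnd a b => And (psubst s a) (psubst s b)
  end.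

Inductive IP (P : Type) (p0 : P) : form P -> Prop :=
| IP_taut t s : tautology t -> IP p0 (psubst s t)
| IP_mp a b : IP p0 a -> IP p0 (Imp a b) -> IP p0 b
| IP_nec a : IP p0 a -> IP p0 (Geq a (Top p0))
| IP_A1 a : IP p0 (Geq a (Bot p0))
| IP_A2 a : IP p0 (Geq a a)
| IP_A3 : IP p0 (Neg (Geq (Bot p0) (Top p0)))
| IP_A4 n k (phi psi : n.-tuple (form P)) (phi' psi' : form P) :
    0 < k ->
    IP p0
      (Imp
        (bigAnd p0
          (rcons [seq Geq x.1 x.2 | x <- zip phi psi]
             (Geq (balanced p0 (cat_tuple phi (nseq_tuple k phi'))
                               (cat_tuple psi (nseq_tuple k psi')))
                  (Top p0))))
        (Geq psi' phi'))
| IP_I1 a b : IP p0 (Imp (Geq a b) (Geq (Geq a b) (Top p0)))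
| IP_I2 a b : IP p0 (Imp (Neg (Geq a b)) (Geq (Neg (Geq a b)) (Top p0))).

(* Main.v *)
(* Soundness of (A4'): by Hall's theorem, A >=^i B holds in a finite model iff
   every upset contains at least as many elements of A as of B, and such
   counting inequalities can be added and cancelled.

   Completeness: extend the negation of an unprovable phi to a maximal
   consistent set v, and consider the finitely many truth assignments to the
   formulas compared inside phi that are realised by maximal consistent sets
   with the same comparisons as v.  For each comparison a >= b rejected by v,
   Farkas' lemma together with (A4') gives a weight on these assignments that
   respects all accepted comparisons but makes b heavier than a.  Stack these weights as
   the layers of a total preorder, each layer outweighing all the better ones:
   upsets are unions of initial layers, so accepted comparisons hold, and each
   rejected one fails on some initial stack of layers. *)
From mathcomp Require Import all_classical.
From mathcomp Require Import all_boot all_order all_algebra.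
From mathcomp Require Import zify.
Require Import Defs.

Set Implicit Arguments.
Unset Strict Implicit.
Unset Printing Implicit Defensive.

(** * Hall's theorem *)

Definition nbhd (T T' : finType) (r : T -> pred T') (A : {set T'})
    (X : {set T}) : {set T'} := [set y in A | [exists x in X, r x y]].

(** Induction on the size of [B]. If some nonempty proper [X] is tight, match [X] and [B :\: X]
    separately; otherwise match [x0] to any neighbour and delete both. [f0] serves as the matching
    of the empty set. *)
Lemma hall (T T' : finType) (r : T -> pred T') (f0 : T -> T')
    (B : {set T}) (A : {set T'}) :
    (forall X : {set T}, X \subset B -> #|X| <= #|nbhd r A X|) ->
  exists f : T -> T',
    {in B &, injective f} /\ {in B, forall x, (f x \in A) && r x (f x)}.
Proof.
have [n] := ubnP #|B|; elim: n B A => // n IHn B A ltBn hallB.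
have [->|[x0 Bx0]] := set_0Vmem B.
  by exists f0; split=> [x y|x]; rewrite inE.
have [/existsP[X /and3P[prX nX0 /eqP eqX]]|/existsPn noX] := boolP
    [exists X : {set T}, [&& X \proper B, X != set0 & #|X| == #|nbhd r A X|]].
- have sXB := proper_sub prX.
  have [//||f [injf okf]] := IHn X A.
  + by apply: leq_trans (proper_card prX) _; rewrite -ltnS.
  + by move=> Y sYX; apply: hallB; apply: subset_trans sXB.
  have [||g [injg okg]] := IHn (B :\: X) (A :\: nbhd r A X).
  + rewrite -ltnS; apply: leq_trans ltBn; rewrite ltnS proper_card //.
    rewrite properEneq subsetDl andbT; apply: contra nX0 => /eqP eqBX.
    rewrite -subset0; apply/subsetP => x Xx.
    by have := subsetP sXB _ Xx; rewrite -eqBX !inE Xx.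
  + move=> Y /subsetDP[sYB dYX].
    (* Hall's condition for [X :|: Y], minus the tight equation for [X]. *)
    have := hallB (X :|: Y); rewrite subUset sXB sYB => /(_ isT).
    rewrite cardsU disjoint_setI0 1?disjoint_sym // cards0 subn0 eqX => leXY.
    have: #|nbhd r A (X :|: Y)| <=
          #|nbhd r A X :|: nbhd r (A :\: nbhd r A X) Y|.
      apply: subset_leq_card; apply/subsetP => y.
      rewrite !inE => /andP[Ay /existsP[x /andP[]]]; rewrite Ay !inE /=.
      case: existsP => //= nXy /orP[Xx|Yx] rxy.
        by case: nXy; exists x; rewrite Xx.
      by apply/existsP; exists x; rewrite Yx.
    by rewrite cardsU; lia.
  exists (fun x => if x \in X then f x else g x); split=> [x y Bx By|x Bx].
  (* [f] maps [X] into the neighbourhood that [g] avoids. *)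
  + have sep u v : u \in X -> v \in B -> v \notin X -> f u = g v -> False.
      move=> Xu Bv nXv euv; have /andP[Au ru] := okf _ Xu.
      have := okg v; rewrite !inE nXv Bv -euv Au /= => /(_ isT)/andP[+ _].
      by rewrite andbT => /existsPn/(_ u); rewrite Xu ru.
    case: ifPn => Xx; case: ifPn => Xy.
    * exact: injf.
    * by move=> e; case: (sep x y).
    * by move=> e; case: (sep y x).
    * by apply: injg; rewrite !inE ?Xx ?Xy.
  + case: ifPn => Xx; first exact: okf.
    have := okg x; rewrite !inE Xx Bx => /(_ isT)/andP[/andP[_ ->] ->].
    by [].
have [y0 /andP[Ay0 rxy0]] : exists y0, (y0 \in A) && r x0 y0.
  have := hallB [set x0]; rewrite sub1set Bx0 cards1 => /(_ isT).
  case/card_gt0P=> y; rewrite inE => /andP[Ay /existsP[x]].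
  by rewrite inE => /andP[/eqP-> rxy]; exists y; rewrite Ay.
have [||f [injf okf]] := IHn (B :\ x0) (A :\ y0).
- by move: ltBn; rewrite (cardsD1 x0) Bx0 ltnS.
- move=> X sX; have [->|nX0] := eqVneq X set0; first by rewrite cards0.
  have sXB : X \subset B by apply: subset_trans sX (subsetDl _ _).
  have prX : X \proper B.
    apply/properP; split=> //; exists x0 => //; apply/negP => Xx0.
    by have := subsetP sX _ Xx0; rewrite !inE eqxx.
  (* Without tight sets the inequality for [X] is strict, which pays for the loss of [y0]. *)
  have := noX X; rewrite prX nX0 /= => neX; have := hallB _ sXB.
  have: #|nbhd r A X| <= 1 + #|nbhd r (A :\ y0) X|.
    rewrite -(cards1 y0); apply: leq_trans (leq_card_setU _ _).
    apply: subset_leq_card; apply/subsetP => y; rewrite !inE.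
    by case: eqP.
  lia.
exists (fun x => if x == x0 then y0 else f x); split=> [x y Bx By|x Bx].
- have sep u : u \in B -> u != x0 -> f u <> y0.
    move=> Bu nu eu; have := okf u.
    by rewrite !inE nu Bu eu eqxx => /(_ isT).
  case: (eqVneq x x0) => [->|nx]; case: (eqVneq y x0) => [->|ny] // e.
  + by case: (sep y).
  + by case: (sep x).
  + by apply: injf; rewrite ?inE ?nx ?ny.
- case: (eqVneq x x0) => [->|nx]; first by rewrite Ay0.
  by have := okf x; rewrite !inE nx Bx => /(_ isT)/andP[/andP[_ ->] ->].
Qed.

(** * Boolean valuations *)

(** Common to satisfaction at a world and membership in a maximal consistent set. *)
Definition boolean P (v : form P -> bool) : Prop :=
  (forall a, v (Neg a) = ~~ v a) * (forall a b, v (And a b) = v a && v b).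

Section Boolean.
Variables (P : Type) (p0 : P) (v : form P -> bool).
Hypothesis hv : boolean v.

Lemma booleanImp a b : v (Imp a b) = (v a ==> v b).
Proof. by rewrite !hv negb_and negbK implybE. Qed.

Lemma booleanBot : v (Bot p0) = false.
Proof. by rewrite !hv andbN. Qed.

Lemma booleanTop : v (Top p0).
Proof. by rewrite hv booleanBot. Qed.

Lemma boolean_bigAnd s : v (bigAnd p0 s) = all v s.
Proof.
elim: s => [|a [|b s] IHs] /=; first exact: booleanTop.
  by rewrite andbT.
by rewrite hv; congr (_ && _).
Qed.

Lemma boolean_bigOr s : v (bigOr p0 s) = has v s.
Proof.
elim: s => [|a [|b s] IHs] /=; first exact: booleanBot.
  by rewrite orbF.
by rewrite /Or !hv negb_and !negbK; congr (_ || _).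
Qed.

Lemma boolean_lits (f : seq bool) s :
  size f = size s -> all v [seq lit x.1 x.2 | x <- zip f s] = (f == map v s).
Proof.
elim: f s => [|b f IHf] [|a s] //= [/IHf->].
by rewrite eqseq_cons; case: b; rewrite /lit /= ?hv; case: (v a).
Qed.

Lemma has_allpairs (S T U : Type) (q : pred U) (f : S -> T -> U) s t :
  has q [seq f x y | x <- s, y <- t] = has (fun x => has (q \o f x) t) s.
Proof. by elim: s => //= x s IHs; rewrite has_cat has_map IHs. Qed.

Lemma boolean_balC m (phi psi : m.-tuple (form P)) j :
  v (balC p0 phi psi j) = (count v phi == j) && (count v psi == j).
Proof.
rewrite /balC boolean_bigOr has_allpairs.
apply/hasP/andP => /= [[f]|[cphi cpsi]].
  rewrite mem_filter => /andP[/eqP cf _] /hasP[g].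
  rewrite mem_filter => /andP[/eqP cg _] /=.
  rewrite boolean_bigAnd all_cat !boolean_lits ?size_tuple //.
  by move=> /andP[/eqP ef /eqP eg]; rewrite -{1}cf -cg ef eg !count_map.
exists (map_tuple v phi).
  by rewrite mem_filter mem_enum count_map andbT.
apply/hasP; exists (map_tuple v psi).
  by rewrite mem_filter mem_enum count_map andbT.
by rewrite /= boolean_bigAnd all_cat !boolean_lits ?size_tuple ?size_map ?eqxx.
Qed.

Lemma boolean_balanced m (phi psi : m.-tuple (form P)) :
  v (balanced p0 phi psi) = (count v phi == count v psi).
Proof.
rewrite /balanced boolean_bigOr has_map.
apply/hasP/eqP => /= [[j _]|eqc].
  by rewrite boolean_balC => /andP[/eqP-> /eqP->].
exists (count v phi); last by rewrite /= boolean_balC -eqc eqxx.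
rewrite -[_ :: _]/(iota 0 m.+1) mem_iota add0n ltnS /=.
by have := count_size v phi; rewrite size_tuple.
Qed.
End Boolean.

Lemma boolean_sat P (M : model P) (w : M) : boolean (fun a => `[<sat w a>]).
Proof. by split=> [a|a b]; rewrite /= ?asbool_neg ?asbool_and. Qed.

Lemma boolean_psubst P (v : form P -> bool) s t :
  boolean v -> v (psubst s t) = peval (fun i => v (s i)) t.
Proof. by move=> hv; elim: t => //= [t <-|t <- u <-]; rewrite hv. Qed.

(** * Soundness *)

Section FiniteModel.
Variables (P : Type) (M : model P) (T : finType) (d : T -> M).

Definition upset (U : {set T}) : Prop :=
  forall x y, pref (d y) (d x) -> x \in U -> y \in U.

Definition trace (A : set M) : {set T} := [set x | `[<A (d x)>]].

(** An inflationary injection keeps upsets, which gives the counting inequalities. Conversely, the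
    neighbours of [X] in Hall's theorem are the part in [A] of the upset generated by [X], and that
    upset contains [X] by reflexivity. *)
Lemma infl_geP (A B : set M) :
    bijective d -> (forall x, B x -> dom x) ->
  infl_ge A B <->
  forall U, upset U -> #|U :&: trace B| <= #|U :&: trace A|.
Proof.
move=> [d' dK d'K] domB; split=> [[f [funf injf inflf]] U upU|leU].
  have injg : {in U :&: trace B &, injective (d' \o f \o d)}.
    move=> x y; rewrite !inE => /andP[_ /asboolP Bx] /andP[_ /asboolP By] /=.
    move=> /(can_inj d'K)/injf; rewrite !in_setE => /(_ Bx By).
    exact: (can_inj dK).
  rewrite -(card_in_imset injg); apply/subset_leq_card/subsetP => y /imsetP[x].
  rewrite !inE => /andP[Ux /asboolP Bx] -> /=.
  apply/andP; split; last by apply/asboolP; rewrite d'K; exact: funf.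
  by apply: upU Ux; rewrite d'K; exact: inflf.
pose r x := [pred y | `[<pref (d y) (d x)>]].
have [X sXB|f [injf okf]] := @hall _ _ r id (trace B) (trace A).
  pose U := [set y | [exists x in X, r x y]].
  have -> : nbhd r (trace A) X = U :&: trace A.
    by apply/setP => y; rewrite !inE andbC.
  apply: leq_trans (leU U _).
    apply/subset_leq_card/subsetP => x Xx; rewrite !inE.
    have := subsetP sXB x Xx; rewrite inE => Bx; rewrite Bx andbT.
    apply/existsP; exists x; rewrite Xx; apply/asboolP/pref_refl/domB.
    exact/asboolP.
  move=> x y yx; rewrite !inE => /existsP[z /andP[Xz /asboolP xz]].
  by apply/existsP; exists z; rewrite Xz; apply/asboolP/(pref_trans yx).
have inB x : B x -> d' x \in trace B.
  by move=> Bx; rewrite inE d'K; apply/asboolP.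
exists (d \o f \o d'); split=> [x Bx|x y|x Bx] /=.
- by have /andP[] := okf _ (inB _ Bx); rewrite inE => /asboolP.
- rewrite !in_setE => Bx By /(can_inj dK) /injf.
  by move=> /(_ (inB _ Bx) (inB _ By)) /(can_inj d'K).
- by have /andP[_ /asboolP] := okf _ (inB _ Bx); rewrite d'K.
Qed.
End FiniteModel.

Lemma finite_model_enum P (M : model P) :
  finite_model M -> exists (n : nat) (d : 'I_n -> M), bijective d.
Proof.
move=> /finite_setP[n /card_set_bijP[f [funf injf surjf]]].
pose g x := Ordinal (funf x I : f x < n).
have [i|d dP] := @choice 'I_n M (fun i x => f x = i).
  by have [x _] := surjf i (ltn_ord i); exists x.
exists n, d, g => [i|x]; first exact/val_inj/dP.
by apply: injf; rewrite ?in_setE // dP.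
Qed.

Lemma infl_ge_sub P (M : model P) (A B : set M) :
  (forall x, B x -> dom x /\ A x) -> infl_ge A B.
Proof.
move=> sBA; exists id; split=> [x /sBA[]//|//|x /sBA[domx _]].
exact: pref_refl.
Qed.

Lemma satImp P (M : model P) (w : M) a b :
  sat w (Imp a b) <-> (sat w a -> sat w b).
Proof.
have e : `[<sat w (Imp a b)>] = `[<sat w a>] ==> `[<sat w b>].
  exact: booleanImp (boolean_sat w) a b.
by rewrite -asbool_imply in e; exact: asbool_eq_equiv e.
Qed.

Lemma satTop P p0 (M : model P) (w : M) : sat w (Top p0).
Proof. by apply/asboolP; rewrite (booleanTop p0 (boolean_sat w)). Qed.

Lemma sat_geqTop P p0 (M : model P) (w : M) a :
  (forall x : M, dom x -> sat x a) -> sat w (Geq a (Top p0)).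
Proof.
move=> aT; apply: infl_ge_sub => x [domx _].
by split=> //; split=> //; apply: aT.
Qed.

Section Soundness.
Variables (P : Type) (p0 : P) (M : model P).
Variables (T : finType) (d : T -> M).
Hypothesis bijd : bijective d.

Let ext (a : form P) : {set T} := trace d [set x | dom x /\ sat x a]%classic.

Let sat_geqP (w : M) a b :
  sat w (Geq a b) <-> forall U, upset d U -> #|U :&: ext b| <= #|U :&: ext a|.
Proof. by apply: infl_geP => // x []. Qed.

(** Counting on the upset of all worlds: by finiteness, the extension of [a] must be the whole
    domain. So [Geq _ (Top p0)] is a box over the domain. *)
Lemma geqTop_sat (w x : M) a : sat w (Geq a (Top p0)) -> dom x -> sat x a.
Proof.
have [d' dK d'K] := bijd.
move=> /sat_geqP/(_ [set: T] (fun _ _ _ _ => in_setT _)).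
rewrite !finset.setTI => leTa domx.
have /eqP eTa : ext a == ext (Top p0).
  rewrite eqEcard leTa andbT; apply/subsetP => y; rewrite !inE.
  by move=> /asboolP[domy _]; apply/asboolP; split=> //; exact: satTop.
have: d' x \in ext (Top p0).
  by rewrite inE d'K; apply/asboolP; split=> //; exact: satTop.
by rewrite -eTa inE d'K => /asboolP[].
Qed.

(** Double counting of the pairs of a world in [U] and a formula true there. *)
Lemma sum_card_ext (U : {set T}) (s : seq (form P)) :
  \sum_(a <- s) #|U :&: ext a| =
  \sum_(x in U | `[<dom (d x)>]) count (fun a => `[<sat (d x) a>]) s.
Proof.
under eq_bigr => a _ do rewrite -sum1_card big_mkcond.
rewrite exchange_big [RHS]big_mkcond; apply: eq_bigr => x _ /=.
case: ifP => [Ux|nUx].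
  rewrite -sum1_count [RHS]big_mkcond; apply: eq_bigr => a _.
  by rewrite in_setI inE /= asbool_and andbA Ux.
by rewrite big1 // => a _; rewrite in_setI inE /= asbool_and andbA nUx.
Qed.

(** On each upset, balancedness makes the total sizes of the two lists equal. Subtracting the
    assumed inequalities leaves the wanted one multiplied by [k]. *)
Lemma sound_A4 (w : M) n k (phi psi : n.-tuple (form P)) (phi' psi' : form P) :
    0 < k -> all (fun a => `[<sat w a>]) [seq Geq x.1 x.2 | x <- zip phi psi] ->
    sat w (Geq (balanced p0 (cat_tuple phi (nseq_tuple k phi'))
                            (cat_tuple psi (nseq_tuple k psi'))) (Top p0)) ->
  sat w (Geq psi' phi').
Proof.
move=> k_gt0 geqs geqT; apply/sat_geqP => U upU.
have le_sum : \sum_(b <- psi) #|U :&: ext b| <= \sum_(a <- phi) #|U :&: ext a|.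
  have: size phi = size psi by rewrite !size_tuple.
  move: geqs {geqT}; move: (tval phi) (tval psi).
  elim=> [|a s IHs] [|b t] //= /andP[/asboolP ab geqs] [eqst].
  rewrite !big_cons; apply: leq_add; last exact: IHs.
  by move/sat_geqP: ab; apply.
have: \sum_(a <- phi ++ nseq k phi') #|U :&: ext a| =
      \sum_(a <- psi ++ nseq k psi') #|U :&: ext a|.
  rewrite !sum_card_ext; apply: eq_bigr => x /andP[_ /asboolP domx].
  apply/eqP; have := geqTop_sat geqT domx.
  by move=> /asboolP; rewrite (boolean_balanced p0 (boolean_sat _)).
rewrite !big_cat !big_nseq !iter_addn /=.
move=> esum; rewrite -(leq_pmul2r k_gt0); lia.
Qed.
End Soundness.

Lemma soundness P (p0 : P) phi :
  IP p0 phi -> forall M : model P, finite_model M -> forall w : M, sat w phi.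
Proof.
move=> + M finM; have [n [d bijd]] := finite_model_enum finM.
elim=> {phi} [t s taut|a b _ IHa _ IHab|a _ IHa|a|a|
             |m k phi psi phi' psi' k0|a b|a b] w.
- by apply/asboolP; rewrite (boolean_psubst s t (boolean_sat w)); exact: taut.
- exact: (satImp w a b).1 (IHab w) (IHa w).
- by apply: sat_geqTop.
- apply: infl_ge_sub => x [_ /asboolP].
  by rewrite (booleanBot p0 (boolean_sat x)).
- by apply: infl_ge_sub => x [].
- move=> [f [funf _ _]]; have [x domx] := dom_nonempty M.
  have [|_ /asboolP] := funf x; first by split=> //; exact: satTop.
  by rewrite (booleanBot p0 (boolean_sat _)).
- apply/satImp => /asboolP.
  rewrite (boolean_bigAnd p0 (boolean_sat w)) all_rcons.
  by move=> /andP[/asboolP geqT geqs]; exact: (sound_A4 bijd k0 geqs geqT).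
(* The truth of a comparison does not depend on the world. *)
- by apply/satImp => ab; apply: sat_geqTop.
- by apply/satImp => ab; apply: sat_geqTop.
Qed.

(** * Maximal consistent sets *)

Definition PImp (t u : pform) : pform := PNeg (PAnd t (PNeg u)).

(** Closure under necessitation is not demanded, so that the deduction theorem holds. *)
Definition theory P (p0 : P) (X : set (form P)) : Prop :=
  (forall a, IP p0 a -> X a) /\ (forall a b, X a -> X (Imp a b) -> X b).

(* A maximal consistent set, given by its characteristic function. *)
Definition mcs P (p0 : P) (v : form P -> bool) : Prop :=
  boolean v /\ forall a, IP p0 a -> v a.

Section Lindenbaum.
Variables (P : Type) (p0 : P).

Lemma theory_taut (X : set (form P)) t s :
  theory p0 X -> tautology t -> X (psubst s t).
Proof. by move=> [IPX _] taut; apply/IPX/IP_taut. Qed.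

Lemma theory_deduction (X : set (form P)) a :
  theory p0 X -> theory p0 [set c | X (Imp a c)]%classic.
Proof.
move=> thX; have [IPX mpX] := thX; split=> [c /IPX Xc|c e] /=.
  apply: (mpX _ _ Xc).
  apply: (@theory_taut X (PImp (PVar 0) (PImp (PVar 1) (PVar 0)))
            (nth a [:: c; a]) thX) => v /=.
  by do 2!case: (v _).
move=> Xac Xace; apply: (mpX _ _ Xace); apply: (mpX _ _ Xac).
apply: (@theory_taut X (PImp (PImp (PVar 0) (PVar 1))
          (PImp (PImp (PVar 0) (PImp (PVar 1) (PVar 2)))
             (PImp (PVar 0) (PVar 2))))
          (nth a [:: a; c; e]) thX) => v /=.
by case: (v 0); case: (v 1); case: (v 2).
Qed.

Lemma theory_maximal (X : set (form P)) b :
    theory p0 X -> ~ X b ->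
  exists Y : set (form P), [/\ theory p0 Y, ~ Y b, (X `<=` Y)%classic &
    forall a, Y a \/ Y (Imp a b)].
Proof.
move=> thX nXb.
(* Zorn's lemma is applied to additions [A] to [X], so that the empty chain has the bound [X]. *)
pose Q A := (theory p0 (X `|` A) /\ ~ (X `|` A) b)%classic.
have [F QF totF|A [[thA nAb] maxA]] := @Zorn_bigcup _ Q.
  pose U := (X `|` \bigcup_(A in F) A)%classic.
  (* As [F] is a chain, two members of [U] already lie in one theory inside [U]; this yields closure
     under modus ponens. *)
  have dirU a c : U a -> U c -> exists A,
      [/\ theory p0 A, A a, A c & (A `<=` U)%classic].
    have sFU A : F A -> (X `|` A `<=` U)%classic.
      by move=> FA e [Xe|Ae]; [left|right; exists A].
    move=> [Xa|[A FA Aa]] [Xc|[B FB Bc]].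
    - by exists X; split=> // e Xe; left.
    - exists (X `|` B)%classic.
      by split; [exact: (QF _ FB).1|left|right|exact: sFU].
    - exists (X `|` A)%classic.
      by split; [exact: (QF _ FA).1|right|left|exact: sFU].
    - have [sAB|sBA] := totF _ _ FA FB.
        exists (X `|` B)%classic.
        split; [exact: (QF _ FB).1| |by right|exact: sFU].
        by right; exact: sAB.
      exists (X `|` A)%classic.
      split; [exact: (QF _ FA).1|by right| |exact: sFU].
      by right; exact: sBA.
  split; last by move=> [//|[A /QF[_ nAb] Ab]]; apply: nAb; right.
  split=> [a IPa|a c Ua Uac]; first by left; exact: thX.1.
  have [A [thA Aa Aac sAU]] := dirU _ _ Ua Uac.
  by apply: sAU; exact: thA.2 Aa Aac.
set Y := (X `|` A)%classic in thA nAb.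
exists Y; split=> // [a Xa|a]; first by left.
have [Ya|nYa] := pselect (Y a); first by left.
right; apply: contrapT => nYab.
(* If both alternatives failed, the theory generated by [Y] and [a] would be larger and still avoid
   [b]. *)
pose B := [set c | Y (Imp a c)]%classic.
have thB : theory p0 B := theory_deduction a thA.
have sYB : (Y `<=` B)%classic.
  move=> c Yc; apply: (thA.2 _ _ Yc).
  apply: (@theory_taut Y (PImp (PVar 0) (PImp (PVar 1) (PVar 0)))
            (nth a [:: c; a]) thA) => v /=.
  by do 2!case: (v _).
have Ba : B a.
  apply: (@theory_taut Y (PImp (PVar 0) (PVar 0)) (fun=> a) thA) => v /=.
  by case: (v _).
have eXB : (X `|` B = B)%classic.
  by apply/seteqP; split=> [c [Xc|//]|c]; [apply/sYB; left|right].
apply: (maxA B); last by rewrite /Q eXB.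
split=> [c Ac|sBA]; first by apply: sYB; right.
by apply: nYa; right; exact: sBA.
Qed.

(** A maximal theory avoiding [b] decides every [a]: otherwise it would contain both [Imp a b] and
    [Imp (Neg a) b], hence [b]. *)
Lemma lindenbaum (X : set (form P)) b :
    theory p0 X -> ~ X b ->
  exists v, [/\ mcs p0 v, forall a, X a -> v a & ~~ v b].
Proof.
move=> thX nXb; have [Y [thY nYb sXY maxY]] := theory_maximal thX nXb.
have [IPY mpY] := thY.
exists (fun a => `[<Y a>]); split; last exact/asboolPn.
- split; last by move=> a /IPY Ya; apply/asboolP.
  split=> [a|a c].
    rewrite -asbool_neg; apply: asbool_equiv_eq; split=> [Yna Ya|nYa].
      apply: nYb; apply: (mpY _ _ Yna); apply: (mpY _ _ Ya).
      apply: (@theory_taut Y (PImp (PVar 0) (PImp (PNeg (PVar 0)) (PVar 1)))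
            (nth a [:: a; b]) thY) => v /=.
      by do 2!case: (v _).
    have [//|Ynab] := maxY (Neg a); have [//|Yab] := maxY a.
    case: nYb; apply: (mpY _ _ Ynab); apply: (mpY _ _ Yab).
    apply: (@theory_taut Y (PImp (PImp (PVar 0) (PVar 1))
       (PImp (PImp (PNeg (PVar 0)) (PVar 1)) (PVar 1)))
            (nth a [:: a; b]) thY) => v /=.
    by case: (v 0); case: (v 1).
  rewrite -asbool_and; apply: asbool_equiv_eq; split=> [Yac|[Ya Yc]].
    split; apply: (mpY _ _ Yac).
      apply: (@theory_taut Y (PImp (PAnd (PVar 0) (PVar 1)) (PVar 0))
            (nth a [:: a; c]) thY) => v /=.
      by case: (v 0); case: (v 1).
    apply: (@theory_taut Y (PImp (PAnd (PVar 0) (PVar 1)) (PVar 1))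
            (nth a [:: a; c]) thY) => v /=.
    by case: (v 0); case: (v 1).
  apply: (mpY _ _ Yc); apply: (mpY _ _ Ya).
  apply: (@theory_taut Y
            (PImp (PVar 0) (PImp (PVar 1) (PAnd (PVar 0) (PVar 1))))
            (nth a [:: a; c]) thY) => v /=.
  by case: (v 0); case: (v 1).
- by move=> a /sXY Ya; apply/asboolP.
Qed.

(** Lets derivability be checked by computing truth values. *)
Lemma mcs_complete a : (forall v, mcs p0 v -> v a) -> IP p0 a.
Proof.
move=> allv; apply: contrapT => nIPa.
have [||v [/allv va _]] := @lindenbaum [set c | IP p0 c]%classic a; last first.
- by rewrite va.
- by [].
- by split=> // c e; exact: IP_mp.
Qed.
End Lindenbaum.

(** * The box and cancellation in maximal consistent sets *)

Section Canonical.
Variables (P : Type) (p0 : P).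

(** The accessibility relation of the box [Geq _ (Top p0)]. *)
Definition same_geq (v w : form P -> bool) : Prop :=
  forall a b, w (Geq a b) = v (Geq a b).

Definition balanced_list (L : seq (form P * form P)) k phi' psi' : form P :=
  balanced p0 (cat_tuple (map_tuple fst (in_tuple L)) (nseq_tuple k phi'))
              (cat_tuple (map_tuple snd (in_tuple L)) (nseq_tuple k psi')).

Lemma boolean_balanced_list v L k phi' psi' :
  boolean v ->
  v (balanced_list L k phi' psi') =
  (count (v \o fst) L + v phi' * k == count (v \o snd) L + v psi' * k).
Proof.
by move=> hv; rewrite boolean_balanced //= !count_cat !count_nseq !count_map.
Qed.

Lemma mcs_A4 v L k phi' psi' :
    mcs p0 v -> 0 < k -> all (fun c => v (Geq c.1 c.2)) L ->
    v (Geq (balanced_list L k phi' psi') (Top p0)) ->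
  v (Geq psi' phi').
Proof.
move=> [hv IPv] k_gt0 geqs geqT.
have := IPv _ (IP_A4 p0 (map_tuple fst (in_tuple L))
                 (map_tuple snd (in_tuple L)) phi' psi' k_gt0).
rewrite booleanImp // => /implyP; apply.
rewrite boolean_bigAnd // all_rcons; apply/andP; split=> //.
by rewrite all_map; elim: (L) geqs => //= c s IHs /andP[-> /IHs].
Qed.

(** The box is a normal modality: its distribution over implication comes from (A4') with
    [k = 1]. *)
Lemma mcs_box_theory v :
  mcs p0 v -> theory p0 [set a | v (Geq a (Top p0))]%classic.
Proof.
move=> mv; have [hv IPv] := mv; split=> [a IPa|a b /= va vab].
  exact: IPv (IP_nec IPa).
(* The pair (~ a /\ b, Bot) makes both sides equal:
   [a -> b] + [a] + [~ a /\ b] + 1 = 2 + [b]. *)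
pose L := [:: (Imp a b, Top p0); (a, Top p0); (And (Neg a) b, Bot p0)].
apply: (@mcs_A4 v L 1 (Top p0) b) => //=.
  by rewrite va vab (IPv _ (IP_A1 _ _)).
apply/IPv/IP_nec/mcs_complete => w [hw _].
rewrite boolean_balanced_list //= !(booleanTop p0 hw) (booleanBot p0 hw).
by rewrite booleanImp // !hw; case: (w a); case: (w b).
Qed.

(** If the box of [b] failed, the boxed formulas would extend to a maximal consistent set without
    [b]; (I1) and (I2) force it to have the comparisons of [v]. *)
Lemma mcs_box v b :
    mcs p0 v -> (forall w, mcs p0 w -> same_geq v w -> w b) ->
  v (Geq b (Top p0)).
Proof.
move=> mv allw; have [hv IPv] := mv; apply: contrapT => nvb.
have [w [mw vw]] := lindenbaum (mcs_box_theory mv) nvb.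
rewrite allw // => a c; have [vac|nvac] := boolP (v (Geq a c)).
  apply: vw; move: vac; apply/implyP; rewrite -booleanImp //.
  exact/IPv/IP_I1.
apply/negbTE; rewrite -mw.1; apply: vw; rewrite -hv in nvac.
by move: nvac; apply/implyP; rewrite -booleanImp //; apply/IPv/IP_I2.
Qed.

(** (A4') with the balancedness premise replaced by a count at every accessible set. *)
Lemma mcs_cancel v L k phi' psi' :
    mcs p0 v -> 0 < k -> all (fun c => v (Geq c.1 c.2)) L ->
    (forall w, mcs p0 w -> same_geq v w ->
      count (w \o fst) L + w phi' * k = count (w \o snd) L + w psi' * k) ->
  v (Geq psi' phi').
Proof.
move=> mv k_gt0 geqs allw; apply: (mcs_A4 mv k_gt0 geqs).
apply: mcs_box => // w mw sw; rewrite boolean_balanced_list; last exact: mw.1.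
exact/eqP/allw.
Qed.

End Canonical.

(** * Separating weights *)

Section Separation.
Import GRing.Theory Num.Theory Order.TTheory.
Local Open Scope ring_scope.
Variable S : finType.

Definition dot (u x : {ffun S -> int}) : int := \sum_s u s * x s.

Lemma dotC u x : dot u x = dot x u.
Proof. by apply: eq_bigr => s _; rewrite mulrC. Qed.

Lemma dotDl u v x : dot (u + v) x = dot u x + dot v x.
Proof. by rewrite -big_split; apply: eq_bigr => s _; rewrite ffunE mulrDl. Qed.

Lemma dotDr u x y : dot u (x + y) = dot u x + dot u y.
Proof. by rewrite dotC dotDl !(dotC u). Qed.

Lemma dotNl u x : dot (- u) x = - dot u x.
Proof. by rewrite -sumrN; apply: eq_bigr => s _; rewrite ffunE mulNr. Qed.

Lemma ffunMzE (u : {ffun S -> int}) z s : (u *~ z) s = u s *~ z.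
Proof. by case: z => n; rewrite /intmul ?ffunE !ffunMnE. Qed.

Lemma dotMzl u z x : dot (u *~ z) x = z * dot u x.
Proof.
rewrite mulr_sumr; apply: eq_bigr => s _.
by rewrite ffunMzE mulrzz mulrCA mulrA.
Qed.

Lemma dotMzr u x z : dot u (x *~ z) = z * dot u x.
Proof. by rewrite dotC dotMzl dotC. Qed.

Definition ind (A : {set S}) : {ffun S -> int} := [ffun s => (s \in A)%:R].

Lemma dot_ind A x : dot (ind A) x = \sum_(s in A) x s.
Proof.
rewrite [RHS]big_mkcond; apply: eq_bigr => s _; rewrite ffunE.
by case: (s \in A); rewrite ?mul1r ?mul0r.
Qed.

Variable C : {ffun S -> int} -> Prop.
Hypotheses (C0 : C 0) (CD : forall u v, C u -> C v -> C (u + v)).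

Lemma CMz u z : 0 <= z -> C u -> C (u *~ z).
Proof.
case: z => // n _ Cu; elim: n => [|n IHn]; first by rewrite mulr0z.
by rewrite -addn1 PoszD mulrzDr mulr1z; exact: CD.
Qed.

(* Bartl's proof: if [l] alone does not imply [b], some [x0] witnesses this;
   projecting along [x0] onto the kernel of [a] eliminates [a], and the
   projected vectors are nonnegative combinations, hence again in [C]. *)
Lemma farkas (l : seq {ffun S -> int}) b :
    (forall a, a \in l -> C a) ->
    (forall x, (forall a, a \in l -> 0 <= dot a x) -> 0 <= dot b x) ->
  exists2 k, 0 < k & C (b *~ k).
Proof.
move szl: (size l) => n.
elim: n l szl b => [|n IHn] [|a l] //= => [_|[szl]] b Cl geb.
  exists 1 => //; suff -> : b = 0 by rewrite mul0rz.
  (* The hypothesis is tested on [x = - b]. *)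
  have le0 : dot b b <= 0.
    by rewrite -oppr_ge0 -dotNl dotC; apply: geb.
  have ge0 s : true -> 0 <= b s * b s by rewrite -expr2 sqr_ge0.
  have /eqP : dot b b = 0 by apply/le_anti; rewrite le0 sumr_ge0.
  rewrite /dot psumr_eq0 // => /allP b0; apply/ffunP => s; rewrite ffunE.
  by have := b0 s; rewrite mem_index_enum mulf_eq0 orbb => /(_ isT)/eqP.
have Ca : C a by apply: Cl; rewrite inE eqxx.
have {}Cl u : u \in l -> C u by move=> lu; apply: Cl; rewrite inE lu orbT.
have [lgeb|] :=
    pselect (forall x, (forall u, u \in l -> 0 <= dot u x) -> 0 <= dot b x).
  exact: (IHn l).
move=> /existsNP[x0 /not_implyP[lx0 /negP]]; rewrite -ltNge => bx0.
(* Otherwise [x0] would meet all constraints, including that of [a]. *)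
have ax0 : dot a x0 < 0.
  rewrite ltNge; apply: contraL bx0 => ax0; rewrite -leNgt; apply: geb => u.
  by rewrite inE => /orP[/eqP->|/lx0].
pose c := - dot a x0; have c_gt0 : 0 < c by rewrite oppr_gt0.
(* [proj u] vanishes on [x0]; the factor [c] clears the denominator. *)
pose proj u := u *~ c + a *~ dot u x0.
have dot_proj u x : dot (proj u) x = dot u (x *~ c + x0 *~ dot a x).
  by rewrite dotDl dotDr !dotMzl !dotMzr [dot u x0 * _]mulrC.
have [||x geproj|k k_gt0 Ck] := IHn (map proj l) _ (proj b).
- by rewrite size_map.
- move=> _ /mapP[u lu ->]; apply: CD; apply: CMz => //.
  + exact: ltW.
  + exact: Cl.
  + exact: lx0.
- rewrite dot_proj; apply: geb => u; rewrite inE => /orP[/eqP->|lu].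
    by rewrite dotDr !dotMzr /c mulNr [dot a x * _]mulrC addNr.
  by rewrite -dot_proj; apply: geproj; exact: map_f.
exists (c * k); first exact: mulr_gt0.
(* The coefficient of [a] is nonnegative because [dot b x0 < 0]. *)
have -> : b *~ (c * k) = proj b *~ k + a *~ (- dot b x0 * k).
  rewrite /proj mulrzDl -!mulrzA -addrA -mulrzDr [- dot b x0 * k]mulNr.
  by rewrite addrN mulr0z addr0.
by apply: CD Ck _; apply: CMz Ca; rewrite mulr_ge0 ?oppr_ge0 ?ltW.
Qed.

Definition weight (m : S -> nat) (A : {set S}) : nat := (\sum_(s in A) m s)%N.

(** Farkas' lemma for the differences of indicators, read contrapositively. The singletons are added
    to the constraints to make the separating vector nonnegative, hence a weight. *)
Lemma separation (l : seq ({set S} * {set S})) (A B : {set S}) :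
    (forall s, C (ind [set s])) ->
    (forall c, c \in l -> C (ind c.1 - ind c.2)) ->
    (forall k, 0 < k -> ~ C ((ind A - ind B) *~ k)) ->
  exists m : S -> nat, (forall c, c \in l -> weight m c.2 <= weight m c.1)%N /\
    (weight m A < weight m B)%N.
Proof.
move=> C1 Cl nC; apply: contrapT => nom.
pose l' := [seq ind [set s] | s <- enum S] ++ [seq ind c.1 - ind c.2 | c <- l].
have [u|x l'x|k k_gt0 /nC] := @farkas l' (ind A - ind B); last exact.
  by rewrite mem_cat => /orP[/mapP[s _ ->]|/mapP[c lc ->]]; [|exact: Cl].
have x_ge0 s : 0 <= x s.
  have: 0 <= dot (ind [set s]) x.
    apply: l'x; rewrite mem_cat; apply/orP/or_introl/mapP.
    by exists s; rewrite ?mem_enum.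
  by rewrite dot_ind big_set1.
have dotE D E : dot (ind D - ind E) x =
    (weight (fun s => `|x s|%N) D)%:Z - (weight (fun s => `|x s|%N) E)%:Z.
  rewrite dotDl dotNl !dot_ind /weight -!natz !natr_sum.
  by congr (_ - _); apply: eq_bigr => s _; rewrite natz gez0_abs.
rewrite dotE subr_ge0 leNgt; apply/negP => ltAB; apply: nom.
exists (fun s => `|x s|%N); split=> // c lc.
have: 0 <= dot (ind c.1 - ind c.2) x.
  by apply: l'x; rewrite mem_cat; apply/orP/or_intror/mapP; exists c.
by rewrite dotE subr_ge0.
Qed.
End Separation.

(** * Stacking weights into layers *)

Lemma weightM (S : finType) N (m : S -> nat) A :
  weight (fun s => N * m s) A = N * weight m A.
Proof. by rewrite /weight big_distrr. Qed.

(** Each pair of [l] gets its own layer, put below the earlier ones; earlier pairs keep their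
    witness since the first [J] layers are unchanged. *)
Lemma layers (S : finType) (good l : seq ({set S} * {set S})) :
    (forall c, c \in l -> exists m : S -> nat,
      (forall e, e \in good -> weight m e.2 <= weight m e.1) /\
      weight m c.1 < weight m c.2) ->
  exists (J : nat) (m : nat -> S -> nat),
    (forall j e, e \in good -> weight (m j) e.2 <= weight (m j) e.1) /\
    forall c, c \in l -> exists2 n, n <= J &
      \sum_(j < n) weight (m j) c.1 < \sum_(j < n) weight (m j) c.2.
Proof.
elim: l => [|c l IHl] okl.
  by exists 0, (fun _ _ => 0); split=> // j e _; rewrite /weight !big1.
have [c' lc'|J [m [goodm mP]]] := IHl.
  by apply: okl; rewrite inE lc' orbT.
have [|mc [goodmc mcP]] := okl c; first by rewrite inE eqxx.
(* Scaling by [N] turns a gain of at least 1 in the new layer into more than [c.1] weighs in all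
   earlier ones. *)
pose N := (\sum_(j < J) weight (m j) c.1).+1.
pose m' j := if j < J then m j else (fun s => N * mc s).
have m'E n A : n <= J ->
    \sum_(j < n) weight (m' j) A = \sum_(j < n) weight (m j) A.
  by move=> leJ; apply: eq_bigr => j _; rewrite /m' (leq_trans (ltn_ord j)).
exists J.+1, m'; split=> [j e ge|c'].
  rewrite /m'; case: ifP => _; first exact: goodm.
  by rewrite !weightM leq_mul2l goodmc ?orbT.
rewrite inE => /orP[/eqP->|/mP[n leJ lt]]; last first.
  by exists n; [exact: leqW|rewrite !m'E].
exists J.+1 => //; rewrite !big_ord_recr /= !m'E // /m' ltnn !weightM.
apply: leq_trans (leq_addl _ _); apply: leq_trans (leq_mul (leqnn N) mcP).
by rewrite mulnS -addSn leq_add2r.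
Qed.

(** * Layered models *)

Section LayeredModel.
Variables (P : Type) (S : finType) (J : nat) (m : nat -> S -> nat).
Variable D : S -> form P -> bool.

(** Bounds each [m j s] with [j < J], so that all required copies fit in ['I_N.+1]. *)
Let N := \sum_(j < J) \sum_s m j s.
(* The world (j, s, i) is the i-th copy of the state s in layer j; it lies in
   the domain if i < m j s.  Layer 0 is the best one. *)
Let T : finType := ('I_J * S * 'I_N.+1)%type.

Let wdom (x : T) := x.2 < m x.1.1 x.1.2.

Hypothesis wdom_nonempty : exists x, wdom x.

Definition layered_model : model P.
Proof.
refine (@Model P T [set x | wdom x]%classic
  (fun x y => [/\ wdom x, wdom y & x.1.1 <= y.1.1])
  (fun p => [set x | D x.1.2 (Var p)]%classic) _ _ _ _ _).
- by have [x _] := wdom_nonempty; exists x.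
- by have [x wx] := wdom_nonempty; exists x.
- by move=> x y [].
- by move=> x wx; split.
- by move=> x y z [wx wy xy] [_ wz yz]; split=> //; exact: leq_trans yz.
Defined.

Lemma layered_finite : finite_model layered_model.
Proof. exact: (@finite_finset T). Qed.

Lemma layered_total : total_model layered_model.
Proof.
move=> x y wx wy; have [xy|/ltnW yx] := leqP x.1.1 y.1.1.
  by left; split.
by right; split.
Qed.

Definition label (x : layered_model) : S := (x : T).1.2.

Definition extension (A : {set S}) : set layered_model :=
  [set x | dom x /\ label x \in A]%classic.

Lemma card_layers (K : pred 'I_J) (A : {set S}) :
  #|[set x : T | [&& K x.1.1, x.1.2 \in A & wdom x]]| =
  \sum_(j | K j) weight (m j) A.
Proof.
have leN (j : 'I_J) s : m j s <= N.
  by rewrite /N (bigD1 j) //= (bigD1 s) //= -addnA leq_addr.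
have mE (j : 'I_J) s : m j s = \sum_(c < N.+1 | c < m j s) 1.
  by rewrite -(big_ord_widen _ (fun=> 1)) ?sum1_card ?card_ord // ltnW ?ltnS.
under [RHS]eq_bigr => j _.
  rewrite /weight; under eq_bigr => s _ do rewrite mE.
  over.
rewrite pair_big pair_big_dep -sum1_card.
by apply: eq_bigl => x; rewrite inE /wdom andbA.
Qed.

Let trace_extension A :
  trace (id : T -> layered_model) (extension A) =
  [set x : T | (x.1.2 \in A) && wdom x].
Proof.
apply/setP => x; rewrite !inE andbC.
by apply/asboolP/andP => [[wx Ax]|[wx Ax]].
Qed.

(** Inside the domain, an upset that meets a layer contains it, so its counts are sums of layer
    weights. [K] selects the layers met. *)
Lemma layered_infl_ge (A B : {set S}) :
    (forall j, j < J -> weight (m j) B <= weight (m j) A) ->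
  infl_ge (extension A) (extension B).
Proof.
move=> leBA; apply/(@infl_geP _ layered_model T id) => [|x []//|U upU].
  by exists id.
pose K (j : 'I_J) := [exists x in U, wdom x && (x.1.1 == j)].
have UE E : U :&: trace (id : T -> layered_model) (extension E) =
    [set x : T | [&& K x.1.1, x.1.2 \in E & wdom x]].
  rewrite trace_extension; apply/setP => x; rewrite !inE.
  apply/andP/and3P =>
    [[Ux /andP[Ex wx]]|[/existsP[y /and3P[Uy wy /eqP yx]] Ex wx]].
    by split=> //; apply/existsP; exists x; rewrite Ux wx eqxx.
  split; last by rewrite Ex.
  by apply: (upU y) => //; split=> //; rewrite yx.
rewrite !UE !card_layers; apply: leq_sum => j _; exact: leBA.
Qed.

(** The first [n] layers form an upset that violates the counting condition. *)
Lemma layered_not_infl_ge (A B : {set S}) n :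
    n <= J -> \sum_(j < n) weight (m j) A < \sum_(j < n) weight (m j) B ->
  ~ infl_ge (extension A) (extension B).
Proof.
move=> leJ ltAB /(@infl_geP _ layered_model T id) leBA.
pose U := [set x : T | wdom x && (x.1.1 < n)].
have UE E : #|U :&: trace (id : T -> layered_model) (extension E)| =
    \sum_(j < n) weight (m j) E.
  rewrite (big_ord_widen _ (fun j => weight (m j) E) leJ).
  rewrite -(card_layers (fun j => j < n)) trace_extension.
  by apply: eq_card => x; rewrite !inE; case: wdom; rewrite ?andbF //= !andbT.
move: ltAB; rewrite -!UE ltnNge leBA //.
- by exists id.
- by move=> x [].
move=> x y [wy wx le_yx]; rewrite !inE wy => /andP[_].
exact: leq_ltn_trans.
Qed.

Fixpoint comps (a : form P) : seq (form P * form P) :=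
  match a with
  | Var _ => [::]
  | Neg b => comps b
  | And b c => comps b ++ comps c
  | Geq b c => (b, c) :: comps b ++ comps c
  end.

Definition models (a : form P) : {set S} := [set s | D s a].

Lemma layered_truth (g : form P -> form P -> bool) a :
    (forall s, boolean (D s)) -> (forall s b c, D s (Geq b c) = g b c) ->
    all (fun c => g c.1 c.2 ==
           `[<infl_ge (extension (models c.1)) (extension (models c.2))>])
      (comps a) ->
  forall x : layered_model, sat x a <-> D (label x) a.
Proof.
move=> bD gD; elim: a => [p|a IHa|a IHa b IHb|a IHa b IHb] //=.
- move=> /IHa IH x; rewrite bD; split=> [nsx|/negP nDx sx].
    by apply/negP => /IH.
  by apply: nDx; apply/IH.
- rewrite all_cat => /andP[/IHa{}IHa /IHb{}IHb] x; rewrite bD.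
  by split=> [[/IHa-> /IHb->]|/andP[/IHa ? /IHb ?]].
- rewrite all_cat => /and3P[/eqP gab /IHa{}IHa /IHb{}IHb] x.
  rewrite gD gab.
  have extE c : (forall y : layered_model, sat y c <-> D (label y) c) ->
      [set y : layered_model | dom y /\ sat y c]%classic = extension (models c).
    move=> IH; apply/seteqP; split=> y [domy].
      by move/IH => Dy; split; rewrite ?inE.
    by rewrite inE => /IH.
  by rewrite !extE //; split=> /asboolP.
Qed.
End LayeredModel.

(** * Completeness *)

Section Completeness.
Variables (P : Type) (p0 : P) (v : form P -> bool).
Hypothesis mv : mcs p0 v.

(** A bit vector that no accessible set realises is represented by [v]; only realised vectors are
    recovered from their representatives. *)
Lemma state_representatives n (St : (form P -> bool) -> n.-tuple bool) :
  exists D : n.-tuple bool -> form P -> bool,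
    (forall s, mcs p0 (D s) /\ same_geq v (D s)) /\
    forall w, mcs p0 w -> same_geq v w -> St (D (St w)) = St w.
Proof.
pose Q s w := [/\ mcs p0 w, same_geq v w &
  (exists u, [/\ mcs p0 u, same_geq v u & St u = s]) -> St w = s].
have [s|D QD] := @choice (n.-tuple bool) _ Q.
  have [[u [mu su us]]|] :=
    pselect (exists u, [/\ mcs p0 u, same_geq v u & St u = s]).
    by exists u.
  by exists v; split=> // [].
exists D; split=> [s|w mw sw]; first by have [] := QD s.
by have [_ _] := QD (St w); apply; exists w.
Qed.

Variable phi : form P.

(* (A3) rejects the pair (Bot, Top), so at least one layer is nonempty. *)
Definition comparisons : seq (form P * form P) := (Bot p0, Top p0) :: comps phi.

(** [phi] is included so that the representative of the state of [v] agrees with [v] on [phi]. *)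
Definition sides : seq (form P) :=
  phi :: map fst comparisons ++ map snd comparisons.

Let cs := comparisons.
Let n := size sides.

Definition state (w : form P -> bool) : (size sides).-tuple bool :=
  map_tuple w (in_tuple sides).

Let state_form (s : n.-tuple bool) : form P :=
  bigAnd p0 [seq lit x.1 x.2 | x <- zip s sides].

Let state_formE w s : mcs p0 w -> w (state_form s) = (s == state w).
Proof.
by move=> [hw _]; rewrite (boolean_bigAnd p0 hw) boolean_lits ?size_tuple.
Qed.

Variable D : n.-tuple bool -> form P -> bool.
Hypothesis mD : forall s, mcs p0 (D s) /\ same_geq v (D s).
Hypothesis DK : forall w, mcs p0 w -> same_geq v w ->
  state (D (state w)) = state w.

Let D_sides w : mcs p0 w -> same_geq v w ->
  all (fun a => D (state w) a == w a) sides.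
Proof.
move=> mw sw; have : map (D (state w)) sides = map w sides.
  exact: (congr1 (@tval _ _) (DK mw sw)).
move: (D (state w)) => u.
by elim: sides => //= a s IHs [-> /IHs->]; rewrite eqxx.
Qed.

Let D_phi w : mcs p0 w -> same_geq v w -> D (state w) phi = w phi.
Proof.
by move=> mw sw; have := D_sides mw sw; rewrite /sides /= => /andP[/eqP].
Qed.

Let c_ (i : 'I_(size cs)) := tnth (in_tuple cs) i.

Let D_cs w i : mcs p0 w -> same_geq v w ->
  D (state w) (c_ i).1 = w (c_ i).1 /\ D (state w) (c_ i).2 = w (c_ i).2.
Proof.
move=> mw sw; have := D_sides mw sw; rewrite {1}/sides -cat1s !all_cat !all_map.
move=> /and3P[_ a1 a2].
have e1 := @all_tnthP _ _ _ (in_tuple cs) a1 i.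
have e2 := @all_tnthP _ _ _ (in_tuple cs) a2 i.
by split; apply/eqP.
Qed.

Import GRing.Theory Num.Theory.

(** The cone of vectors certified by accepted comparisons: at each realised state, [u] is the number
    of true left sides minus that of true right sides. *)
Let C (u : {ffun n.-tuple bool -> int}) : Prop :=
  exists2 L : seq (form P * form P), all (fun c => v (Geq c.1 c.2)) L &
    forall w, mcs p0 w -> same_geq v w ->
      ((count (w \o fst) L)%:Z = (count (w \o snd) L)%:Z + u (state w))%R.

Let sets (i : 'I_(size cs)) := (models D (c_ i).1, models D (c_ i).2).

Let pos := [pred i | v (Geq (c_ i).1 (c_ i).2)].

(** If a positive multiple of the rejected difference were in the cone, its list [L] would let
    cancellation prove the rejected comparison. *)
Lemma separating_weight i : ~~ pos i ->
  exists m : n.-tuple bool -> nat,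
    (forall e, e \in [seq sets j | j in pos] -> weight m e.2 <= weight m e.1) /\
    weight m (sets i).1 < weight m (sets i).2.
Proof.
move=> npos; apply: (@separation _ C).
- by exists [::] => // w _ _; rewrite ffunE.
- move=> x y [L1 gL1 cL1] [L2 gL2 cL2]; exists (L1 ++ L2).
    by rewrite all_cat gL1.
  move=> w mw sw; rewrite !count_cat !PoszD cL1 // cL2 // ffunE.
  by rewrite addrACA.
(* By (A1), [state_form s] is at least falsum, and its truth value is the indicator of [s]. *)
- move=> s; exists [:: (state_form s, Bot p0)].
    by rewrite /= andbT; by case: mv => _; apply; exact: IP_A1.
  move=> w mw sw; rewrite /= !addn0 state_formE // (booleanBot p0 mw.1).
  by rewrite ffunE inE eq_sym add0r; case: (_ == _).
- move=> _ /imageP[j pj ->]; exists [:: c_ j]; first by rewrite /= andbT.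
  move=> w mw sw; have [e1 e2] := D_cs j mw sw.
  rewrite /= !addn0 !ffunE !inE e1 e2.
  by case: (w _); case: (w _).
- case=> // k k_gt0 [L gL cL]; move: npos; apply/negP; rewrite negbK /=.
  apply: (mcs_cancel mv (k_gt0 : 0 < k) gL) => w mw sw; have := cL w mw sw.
  have [e1 e2] := D_cs i mw sw.
  rewrite ffunMzE !ffunE !inE e1 e2 !natz mulrzz.
  by case: (w _); case: (w _); lia.
Qed.

Lemma countermodel : exists (M : model P) (x : M),
  [/\ finite_model M, total_model M & sat x phi <-> v phi].
Proof.
have [hv IPv] := mv.
have [c|J [m [posm negm]]] := @layers _ [seq sets j | j in pos]
    [seq sets i | i in [pred i | ~~ pos i]].
  by move=> /imageP[i npos ->]; exact: separating_weight.
have [j [s mjs]] : exists (j : 'I_J) s, 0 < m j s.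
  have neg0 : ~~ pos ord0 by have := IPv _ (IP_A3 p0); rewrite hv.
  have [|k leJ] := negm (sets ord0); first by apply/imageP; exists ord0.
  (* If all multiplicities were 0, the larger side of [ltk] would be 0. *)
  move=> ltk; apply: contrapT => noj; move: ltk; apply/negP; rewrite -leqNgt.
  rewrite [X in X <= _]big1 // => j _; rewrite /weight big1 // => s _.
  apply/eqP; rewrite -leqn0 leqNgt; apply/negP => mjs; apply: noj.
  by exists (widen_ord leJ j), s.
pose N := \sum_(j < J) \sum_s m j s.
have ne : exists x : 'I_J * n.-tuple bool * 'I_N.+1, x.2 < m x.1.1 x.1.2.
  by exists (j, s, ord0).
(* Truth depends only on the label, so any world labelled [state v] serves; it may lie outside the
   domain. *)
exists (layered_model D ne), (j, state v, ord0 : 'I_N.+1); split.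
- exact: layered_finite.
- exact: layered_total.
have sv : same_geq v v by [].
rewrite (layered_truth (g := fun b c => v (Geq b c))); first by rewrite D_phi.
- by move=> s'; have [[]] := mD s'.
- by move=> s' b c; have [_] := mD s'; apply.
have: all (fun c => v (Geq c.1 c.2) == `[<infl_ge
    (extension (D := D) (wdom_nonempty := ne) (models D c.1))
    (extension (models D c.2))>]) cs.
  rewrite -[cs]/(tval (in_tuple cs)).
  apply/all_tnthP => i; rewrite -/(c_ i).
  apply/eqP/esym; have [posi|npos] := boolP (v _).
    apply/asboolP/layered_infl_ge => k _; apply: (posm k (sets i)).
    by apply/imageP; exists i.
  apply/asboolPn; have [|k leJ lt] := negm (sets i).
    by apply/imageP; exists i.
  exact: layered_not_infl_ge leJ lt.
by case/andP.
Qed.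
End Completeness.

Theorem theorem5 (P : Type) (p0 : P) :
  (forall phi : form P,
     IP p0 phi <->
     (forall M : model P, finite_model M -> forall w : M, sat w phi)) /\
  (forall phi : form P,
     (forall M : model P, finite_model M -> total_model M ->
        forall w : M, sat w phi) ->
     IP p0 phi).
Proof.
have complete phi : (forall M : model P, finite_model M -> total_model M ->
    forall w : M, sat w phi) -> IP p0 phi.
  move=> allM; apply: mcs_complete => v mv.
  have [D [mD DK]] := @state_representatives _ _ _ mv _
    (state p0 phi).
  have [M [x [finM totM sat_phi]]] := countermodel mv mD DK.
  exact/sat_phi/allM.
split=> // phi; split; first exact: soundness.
by move=> allM; apply: complete => M finM _; exact: allM.
Qed.
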